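(* Let $\mathcal{D}$ be a domain in a (real or complex) Banach space $X$, let $\mathcal{A}$ be a complex unital Banach algebra, let $\mathcal{F}=\{F_t\}_{t\ge0}\subset C(\mathcal{D})$ be a semigroup on $\mathcal{D}$, and let $\mathcal{D}^*\subseteq\mathcal{D}$ be an $\mathcal{F}$-invariant set, i.e. $F_t(\mathcal{D}^* )\subseteq\mathcal{D}^*$ for all $t\ge0$. Let $\{\Gamma_t\}_{t\ge0}\subset C(\mathcal{D},\mathcal{A})$ be a semicocycle over $\mathcal{F}$, differentiable with respect to $t$, with generator $B\in C(\mathcal{D},\mathcal{A})$, and let $K\in\mathbb{R}$. Then $$\sup_{x\in\mathcal{D}^*}\|\Gamma_t(x)\|_{\mathcal{A}}\le e^{Kt}\quad\text{for all } t\ge0$$ if and only if $\mu(B(x))\le K$ for all $x\in\mathcal{D}^*$, where for $a\in\mathcal{A}$ $$\mu(a)=\lim_{t\to0^+}\frac{\|1_{\mathcal{A}}+ta\|_{\mathcal{A}}-1}{t}.$$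
   Context: A domain is a connected open set; $C(\mathcal{D},\mathcal{A})$ is the set of continuous maps $\mathcal{D}\to\mathcal{A}$ and $C(\mathcal{D})$ the set of continuous self-maps of $\mathcal{D}$. The unit satisfies $\|1_{\mathcal{A}}\|=1$. Semigroup on $\mathcal{D}$: a family $\{F_t\}_{t\ge0}\subset C(\mathcal{D})$ with (i) $F_{t+s}=F_t\circ F_s$ for all $t,s\ge 0$; (ii) $\lim_{t\to0^+}F_t(x)=x$ for every $x\in\mathcal{D}$. Semicocycle over $\{F_t\}$: a family of maps $\Gamma_t:\mathcal{D}\to\mathcal{A}$, $t\ge0$, with (a) $\Gamma_t(F_s(x))\Gamma_s(x)=\Gamma_{t+s}(x)$ for all $t,s\ge0$, $x\in\mathcal{D}$; (b) $\lim_{t\to0^+}\Gamma_t(x)=1_{\mathcal{A}}$ for every $x\in\mathcal{D}$. The generator of a semicocycle differentiable with respect to $t$ is $B(x)=\frac{d}{dt}\Gamma_t(x)|_{t=0}$ (one-sided derivative); then $v(t)=\Gamma_t(x)$ solves $\frac{dv}{dt}=B(F_t(x))v$, $v(0)=1_{\mathcal{A}}$. *)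

(* Defs.v *)
From Stdlib Require Import Reals Lra Classical_Prop.
From Coquelicot Require Import Coquelicot.
Open Scope R_scope.

Inductive scalar_kind : Set := RealScalars | ComplexScalars.

Definition scalars (k : scalar_kind) : AbsRing :=
  match k with RealScalars => R_AbsRing | ComplexScalars => C_AbsRing end.

Record BanachAlgebra : Type := {
  ba_space :> CompleteNormedModule C_AbsRing;
  ba_ring : Ring.mixin_of ba_space;
  ba_scal_l : forall (c : C) (a b : ba_space),
    Ring.mult _ ba_ring (scal c a) b = scal c (Ring.mult _ ba_ring a b);
  ba_scal_r : forall (c : C) (a b : ba_space),
    Ring.mult _ ba_ring a (scal c b) = scal c (Ring.mult _ ba_ring a b);
  ba_norm_mult : forall a b : ba_space,
    norm (Ring.mult _ ba_ring a b) <= norm a * norm b;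
  ba_norm_one : norm (Ring.one _ ba_ring) = 1
}.

Definition ba_mult {A : BanachAlgebra} : A -> A -> A := Ring.mult _ (ba_ring A).
Definition ba_one {A : BanachAlgebra} : A := Ring.one _ (ba_ring A).

Definition rscal {A : BanachAlgebra} (r : R) (a : A) : A := scal (RtoC r) a.

Definition connected_set {T : UniformSpace} (D : T -> Prop) : Prop :=
  ~ exists U V : T -> Prop,
      open U /\ open V /\
      (forall x, D x -> U x \/ V x) /\
      (exists x, D x /\ U x) /\ (exists x, D x /\ V x) /\
      (forall x, ~ (D x /\ U x /\ V x)).

Definition is_domain {T : UniformSpace} (D : T -> Prop) : Prop :=
  open D /\ connected_set D.

(* Families indexed by t >= 0 are total in t and x; only their values for
   t >= 0 and x in D are constrained. *)

Definition semigroup_on {T : UniformSpace} (D : T -> Prop) (F : R -> T -> T) : Prop :=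
  (forall t, 0 <= t -> forall x, D x -> D (F t x)) /\
  (forall t, 0 <= t -> continuous_on D (F t)) /\
  (forall t s, 0 <= t -> 0 <= s -> forall x, D x -> F (t + s) x = F t (F s x)) /\
  (forall x, D x -> filterlim (fun t => F t x) (at_right 0) (locally x)).

Definition invariant {T : UniformSpace} (F : R -> T -> T) (S : T -> Prop) : Prop :=
  forall t, 0 <= t -> forall x, S x -> S (F t x).

Definition semicocycle {T : UniformSpace} {A : BanachAlgebra} (D : T -> Prop)
    (F : R -> T -> T) (G : R -> T -> A) : Prop :=
  (forall t s, 0 <= t -> 0 <= s -> forall x, D x ->
     ba_mult (G t (F s x)) (G s x) = G (t + s) x) /\
  (forall x, D x -> filterlim (fun t => G t x) (at_right 0) (locally ba_one)).

(* Derivative at t of a map on the half-line [0, +oo): two-sided for t > 0,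
   from the right for t = 0. *)
Definition is_derive_halfline {A : BanachAlgebra} (v : R -> A) (t : R) (l : A) : Prop :=
  filterlim (fun h => rscal (/ h) (minus (v (t + h)) (v t)))
    (within (fun h => 0 <= t + h) (locally' 0)) (locally l).

Definition differentiable_in_time {T : UniformSpace} {A : BanachAlgebra}
    (D : T -> Prop) (G : R -> T -> A) : Prop :=
  forall x, D x -> forall t, 0 <= t ->
    exists l : A, is_derive_halfline (fun s => G s x) t l.

Definition is_generator {T : UniformSpace} {A : BanachAlgebra}
    (D : T -> Prop) (G : R -> T -> A) (B : T -> A) : Prop :=
  forall x, D x -> is_derive_halfline (fun s => G s x) 0 (B x).

Definition mu_quotient {A : BanachAlgebra} (a : A) (t : R) : R :=
  (norm (plus ba_one (rscal t a)) - 1) / t.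

Definition is_mu {A : BanachAlgebra} (a : A) (m : R) : Prop :=
  filterlim (mu_quotient a) (at_right 0) (locally m).

(* [iota] selects the unique real with the given property; [mu_correct] shows
   that the limit always exists. *)
Definition mu {A : BanachAlgebra} (a : A) : R := iota (is_mu a).

Lemma norm_rscal {A : BanachAlgebra} (r : R) (a : A) :
  norm (rscal r a) <= Rabs r * norm a.
Proof.
  rewrite <- Cmod_R. exact (@norm_scal C_AbsRing A (RtoC r) a).
Qed.

Lemma mu_quotient_lower {A : BanachAlgebra} (a : A) t :
  0 < t -> - norm a <= mu_quotient a t.
Proof.
  intros Ht. unfold mu_quotient.
  apply (Rmult_le_reg_r t); [easy|].
  replace ((norm (plus ba_one (rscal t a)) - 1) / t * t)
    with (norm (plus ba_one (rscal t a)) - 1) by (field; lra).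
  pose proof (@norm_triangle_inv C_AbsRing A ba_one (opp (rscal t a))) as H1.
  pose proof (norm_rscal t a) as H2.
  pose proof (@norm_opp C_AbsRing A (rscal t a)) as H4.
  assert (H5 : @minus A ba_one (opp (rscal t a)) = plus ba_one (rscal t a)).
  { unfold minus. f_equal. apply opp_opp. }
  assert (H1' : Rabs (norm (@ba_one A) - norm (rscal t a))
                <= norm (plus ba_one (rscal t a))).
  { rewrite <- H4, <- H5. exact H1. }
  assert (H3 : norm (@ba_one A) = 1) by exact (ba_norm_one A).
  rewrite H3 in H1'. rewrite Rabs_right in H2 by lra.
  pose proof (Rle_abs (1 - norm (rscal t a))). lra.
Qed.

Lemma mu_quotient_mono {A : BanachAlgebra} (a : A) s t :
  0 < s -> s <= t -> mu_quotient a s <= mu_quotient a t.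
Proof.
  intros Hs Hst.
  set (r := s / t).
  assert (Hr : 0 <= r <= 1).
  { unfold r; split; [apply Rlt_le, Rdiv_lt_0_compat; lra|].
    apply (Rmult_le_reg_r t); [lra|]. replace (s / t * t) with s by (field; lra). lra. }
  assert (E : plus ba_one (rscal s a) =
      plus (rscal (1 - r) ba_one) (rscal r (plus ba_one (rscal t a)))).
  { assert (E1 : rscal r (plus ba_one (rscal t a)) =
                 plus (rscal r ba_one) (rscal r (rscal t a)))
      by exact (@scal_distr_l C_Ring A (RtoC r) ba_one (rscal t a)).
    assert (E2 : rscal r (rscal t a) = rscal s a).
    { transitivity (@scal C_Ring A (Cmult (RtoC r) (RtoC t)) a).
      - exact (@scal_assoc C_Ring A (RtoC r) (RtoC t) a).
      - rewrite <- RtoC_mult. unfold rscal. f_equal. f_equal.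
        unfold r. field. lra. }
    assert (E3 : plus (rscal (1 - r) ba_one) (rscal r ba_one) = @ba_one A).
    { transitivity (@scal C_Ring A (Cplus (RtoC (1 - r)) (RtoC r)) ba_one).
      - symmetry. exact (@scal_distr_r C_Ring A (RtoC (1 - r)) (RtoC r) ba_one).
      - rewrite <- RtoC_plus. replace (1 - r + r) with 1 by ring.
        exact (@scal_one C_Ring A ba_one). }
    rewrite E1, E2, plus_assoc, E3. reflexivity. }
  assert (H : norm (plus ba_one (rscal s a)) <=
              (1 - r) + r * norm (plus ba_one (rscal t a))).
  { rewrite E. eapply Rle_trans; [exact (@norm_triangle C_AbsRing A _ _)|].
    apply Rplus_le_compat.
    - eapply Rle_trans; [apply norm_rscal|].
      assert (H3 : norm (@ba_one A) = 1) by exact (ba_norm_one A).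
      rewrite H3, Rabs_right; lra.
    - eapply Rle_trans; [apply norm_rscal|]. rewrite Rabs_right; lra. }
  unfold mu_quotient.
  apply (Rmult_le_reg_r s); [lra|].
  replace ((norm (plus ba_one (rscal s a)) - 1) / s * s)
    with (norm (plus ba_one (rscal s a)) - 1) by (field; lra).
  replace ((norm (plus ba_one (rscal t a)) - 1) / t * s)
    with (r * (norm (plus ba_one (rscal t a)) - 1)) by (unfold r; field; lra).
  lra.
Qed.

Lemma mu_correct {A : BanachAlgebra} (a : A) : is_mu a (mu a).
Proof.
  assert (Hex : exists m, is_mu a m).
  { destruct (completeness (fun y => exists t, 0 < t /\ y = - mu_quotient a t))
      as [M [Hub Hlub]].
    - exists (norm a). intros y (t & Ht & ->).
      pose proof (mu_quotient_lower a t Ht). lra.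
    - exists (- mu_quotient a 1), 1. split; [lra|easy].
    - exists (- M). intros P [eps HP].
      assert (Hn : exists t, 0 < t /\ mu_quotient a t < - M + eps).
      { apply NNPP. intros Hn.
        assert (M <= M - eps); [|pose proof (cond_pos eps); lra].
        apply Hlub. intros y (t & Ht & ->).
        destruct (Rlt_le_dec (mu_quotient a t) (- M + eps)) as [H|H]; [|lra].
        exfalso; apply Hn; now exists t. }
      destruct Hn as (t & Ht & Hlt).
      exists (mkposreal t Ht). intros s Hs Hs0. apply HP.
      change (Rabs (s - 0) < t) in Hs.
      assert (s < t) by (pose proof (Rle_abs (s - 0)); lra).
      pose proof (mu_quotient_mono a s t Hs0 ltac:(lra)).
      assert (- mu_quotient a s <= M) by (apply Hub; now exists s).
      change (Rabs (mu_quotient a s - - M) < eps).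
      apply Rabs_def1; pose proof (cond_pos eps); lra. }
  destruct Hex as [m Hm].
  replace (mu a) with m; [exact Hm|].
  symmetry. exact (iota_filterlim_locally (F := at_right 0) (mu_quotient a) m Hm).
Qed.

(* Main.v *)
(** The two conditions are compared through the first order expansion
    [Gamma_h(y) = 1 + h B(y) + o(h)], which gives
    [(|Gamma_h(y)| - 1) / h -> mu (B y)] as [h -> 0+].  The exponential bound thus
    forces [mu (B y) <= K].  Conversely, if [mu (B y) <= K] on [Dstar] then, for
    every [eps > 0], the cocycle identity [Gamma_{t+h}(x) = Gamma_h(F_t x) Gamma_t(x)]
    yields [|Gamma_{t+h}(x)| <= (1 + (K + eps) h) |Gamma_t(x)|] for small [h > 0];
    as [t -> |Gamma_t(x)|] is continuous, a Gronwall argument by real induction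
    gives [|Gamma_t(x)| <= exp ((K + eps) t)]. *)
Require Import Defs.
From Stdlib Require Import Reals Lra Classical_Prop.
From Coquelicot Require Import Coquelicot.
Open Scope R_scope.

(** * Real induction and a one-sided Gronwall inequality *)

(** The step sizes [d] may shrink along the half-line, so iterating steps could stall. The supremum
    of the [s] in [0, T] with [P] on all of [0, s] inherits [P] from the left, and a further step
    there would pass it unless it is [T]. *)
Lemma real_induction (P : R -> Prop) :
  P 0 ->
  (forall t, 0 <= t -> P t ->
     exists d, 0 < d /\ forall h, 0 < h < d -> P (t + h)) ->
  (forall t, 0 < t -> (forall s, 0 <= s < t -> P s) -> P t) ->
  forall t, 0 <= t -> P t.
Proof.
  intros H0 Hright Hleft T HT.
  set (E := fun s => 0 <= s <= T /\ forall r, 0 <= r <= s -> P r).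
  assert (E0 : E 0).
  { split; [lra|]. intros r Hr. now replace r with 0 by lra. }
  destruct (completeness E) as [m [Hub Hlub]].
  { exists T. intros s [Hs _]; lra. }
  { now exists 0. }
  assert (Hm0 : 0 <= m) by now apply Hub.
  assert (HmT : m <= T) by (apply Hlub; intros s [Hs _]; lra).
  assert (Hbelow : forall r, 0 <= r < m -> P r).
  { intros r Hr. apply NNPP. intros Hn.
    enough (m <= r) by lra.
    apply Hlub. intros s [Hs HP].
    destruct (Rle_lt_dec s r) as [|Hrs]; [easy|].
    exfalso. apply Hn, HP. lra. }
  assert (Hm : P m).
  { destruct (Req_dec m 0) as [->|]; [easy|]. apply Hleft; [lra|easy]. }
  destruct (Rle_lt_or_eq_dec m T HmT) as [Hlt| <-]; [|easy].
  destruct (Hright m Hm0 Hm) as (d & Hd & Hstep).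
  (* Halving [d] makes [e] a strictly admissible step; the other bound keeps [m + e] within
     [0, T]. *)
  set (e := Rmin (d / 2) (T - m)).
  assert (He : 0 < e /\ e < d /\ e <= T - m).
  { unfold e. pose proof (Rmin_l (d / 2) (T - m)).
    pose proof (Rmin_r (d / 2) (T - m)).
    repeat split; try lra. apply Rmin_glb_lt; lra. }
  enough (m + e <= m) by lra.
  apply Hub. split; [lra|]. intros r Hr.
  destruct (Rtotal_order r m) as [|[->|]]; [apply Hbelow; lra|easy|].
  replace r with (m + (r - m)) by ring. apply Hstep. lra.
Qed.

(** Since 1 + L h <= exp (L h) for either sign of [L], each right step preserves the exponential
    bound. The third hypothesis prevents an upward jump of [f] on arrival at [t] from the left, so
    the bound survives left limits. *)
Lemma gronwall_right_step (f : R -> R) (L : R) :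
  (forall t, 0 <= f t) ->
  (forall t, 0 <= t ->
     exists d, 0 < d /\ forall h, 0 < h < d -> f (t + h) <= (1 + L * h) * f t) ->
  (forall t, 0 < t -> forall e, 0 < e ->
     exists d, 0 < d /\ forall s, 0 <= s -> t - d < s < t -> f t <= f s + e) ->
  forall t, 0 <= t -> f t <= f 0 * exp (L * t).
Proof.
  intros Hpos Hstep Hlsc. apply real_induction.
  - rewrite Rmult_0_r, exp_0. lra.
  - intros t Ht IH. destruct (Hstep t Ht) as (d & Hd & Hf).
    exists d. split; [easy|]. intros h Hh.
    apply Rle_trans with (1 := Hf h Hh).
    apply Rle_trans with (exp (L * h) * f t).
    + apply Rmult_le_compat_r; [apply Hpos|]. apply exp_ineq1_le.
    + rewrite Rmult_plus_distr_l, exp_plus.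
      replace (f 0 * (exp (L * t) * exp (L * h)))
        with (exp (L * h) * (f 0 * exp (L * t))) by ring.
      apply Rmult_le_compat_l; [apply Rlt_le, exp_pos|easy].
  - intros t Ht IH. apply le_epsilon. intros e He.
    destruct (Hlsc t Ht (e / 2) ltac:(lra)) as (d & Hd & Hf).
    assert (Hc : continuous (fun s => f 0 * exp (L * s)) t).
    { apply (@ex_derive_continuous R_AbsRing R_NormedModule).
      auto_derive. easy. }
    destruct (proj1 (filterlim_locally _ _) Hc (mkposreal (e / 2) ltac:(lra)))
      as [[d' Hd'] Hexp].
    set (r := Rmin t (Rmin d d')).
    assert (Hr : 0 < r /\ r <= t /\ r <= d /\ r <= d').
    { unfold r. pose proof (Rmin_l t (Rmin d d')). pose proof (Rmin_r t (Rmin d d')).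
      pose proof (Rmin_l d d'). pose proof (Rmin_r d d').
      repeat split; try lra. repeat apply Rmin_glb_lt; lra. }
    (* This point is within both radii to the left of [t], and [r <= t] keeps it positive, so the
       induction hypothesis applies. *)
    set (s := t - r / 2).
    assert (Hs1 := Hf s ltac:(unfold s; lra) ltac:(unfold s; lra)).
    assert (Hs2 := IH s ltac:(unfold s; lra)).
    assert (Hs3 : Rabs (f 0 * exp (L * s) - f 0 * exp (L * t)) < e / 2).
    { apply (Hexp s). change (Rabs (s - t) < d').
      unfold s. apply Rabs_def1; lra. }
    apply Rabs_def2 in Hs3. lra.
Qed.

(** * Quantitative consequences of half-line differentiability *)

Lemma rscal_inv {A : BanachAlgebra} (h : R) (a : A) :
  h <> 0 -> rscal h (rscal (/ h) a) = a.
Proof.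
  intros Hh. transitivity (@scal C_Ring A (Cmult (RtoC h) (RtoC (/ h))) a).
  - exact (@scal_assoc C_Ring A (RtoC h) (RtoC (/ h)) a).
  - rewrite <- RtoC_mult, Rinv_r by easy. exact (@scal_one C_Ring A a).
Qed.

Lemma minus_minus {A : BanachAlgebra} (a b c : A) :
  minus (minus a b) c = minus a (plus b c).
Proof.
  unfold minus. rewrite <- plus_assoc. f_equal. symmetry.
  exact (opp_plus b c).
Qed.

Lemma norm_minus_le {A : BanachAlgebra} (a b : A) :
  Rabs (norm a - norm b) <= norm (minus a b).
Proof. exact (@norm_triangle_inv C_AbsRing A a b). Qed.

(** The remainder is [h] times the error of the difference quotient. Negative [h] is allowed when
    [t > 0], which later gives control from the left. *)
Lemma derive_halfline_expansion {A : BanachAlgebra} (v : R -> A) (t : R) (l : A) :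
  is_derive_halfline v t l ->
  forall e, 0 < e -> exists d, 0 < d /\
    forall h, h <> 0 -> Rabs h < d -> 0 <= t + h ->
      norm (minus (v (t + h)) (plus (v t) (rscal h l))) <= e * Rabs h.
Proof.
  intros Hv e He.
  destruct (proj1 (@filterlim_locally_ball_norm C_AbsRing _ A _ _ _ _) Hv
              (mkposreal e He)) as [[d Hd] H].
  exists d. split; [easy|]. intros h Hh0 Hhd Hth.
  assert (Hball : ball 0 d h).
  { change (Rabs (h - 0) < d). now rewrite Rminus_0_r. }
  specialize (H h Hball Hh0 Hth).
  set (w := rscal (/ h) (minus (v (t + h)) (v t))) in H.
  change (norm (minus w l) < e) in H.
  assert (E : minus (v (t + h)) (plus (v t) (rscal h l)) = rscal h (minus w l)).
  { transitivity (minus (rscal h w) (rscal h l)).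
    - unfold w. rewrite rscal_inv by easy. symmetry. apply minus_minus.
    - symmetry. exact (@scal_minus_distr_l C_Ring A (RtoC h) w l). }
  rewrite E. eapply Rle_trans; [apply norm_rscal|].
  rewrite Rmult_comm. apply Rmult_le_compat_r; [apply Rabs_pos|]. lra.
Qed.

(** The expansion with tolerance 1 suffices: the linear term contributes [norm l] and the remainder
    1. *)
Lemma derive_halfline_lipschitz {A : BanachAlgebra} (v : R -> A) (t : R) (l : A) :
  is_derive_halfline v t l ->
  exists d, 0 < d /\ forall h, h <> 0 -> Rabs h < d -> 0 <= t + h ->
    norm (minus (v (t + h)) (v t)) <= (1 + norm l) * Rabs h.
Proof.
  intros Hv. destruct (derive_halfline_expansion v t l Hv 1 Rlt_0_1) as (d & Hd & H).
  exists d. split; [easy|]. intros h Hh0 Hhd Hth.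
  specialize (H h Hh0 Hhd Hth). rewrite <- minus_minus in H.
  pose proof (norm_minus_le (minus (v (t + h)) (v t)) (rscal h l)) as H1.
  pose proof (norm_rscal h l) as H2.
  pose proof (Rle_abs (norm (minus (v (t + h)) (v t)) - norm (rscal h l))).
  lra.
Qed.

(** * Behaviour of the semicocycle and of the quotient defining [mu] near time 0 *)

(** The semicocycle axiom fixes only the right limit at 0. Differentiability at 0 makes [G h x] tend
    to [G 0 x] as well, and limits are unique. *)
Lemma semicocycle_at_0 {T : UniformSpace} {A : BanachAlgebra} (D : T -> Prop)
    (F : R -> T -> T) (G : R -> T -> A) (B : T -> A) :
  semicocycle D F G -> is_generator D G B ->
  forall x, D x -> G 0 x = ba_one.
Proof.
  intros [_ Hlim] HB x Dx.
  apply (@filterlim_locally_unique R C_AbsRing A (at_right 0) _ (fun t => G t x));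
    [|now apply Hlim].
  apply (proj2 (@filterlim_locally_ball_norm C_AbsRing _ A _ _ _ _)). intros [e He].
  destruct (derive_halfline_lipschitz _ _ _ (HB x Dx)) as (d & Hd & H).
  pose proof (norm_ge_0 (B x)) as HBx.
  (* The second radius makes the Lipschitz bound smaller than [e]. *)
  assert (Hd' : 0 < Rmin d (e / (1 + norm (B x)))).
  { apply Rmin_glb_lt; [easy|]. apply Rdiv_lt_0_compat; lra. }
  exists (mkposreal _ Hd'). intros h Hh Hh0.
  change (Rabs (h - 0) < Rmin d (e / (1 + norm (B x)))) in Hh.
  rewrite Rminus_0_r in Hh.
  pose proof (Rmin_l d (e / (1 + norm (B x)))).
  pose proof (Rmin_r d (e / (1 + norm (B x)))).
  specialize (H h ltac:(lra) ltac:(lra) ltac:(lra)). rewrite Rplus_0_l in H.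
  change (norm (minus (G h x) (G 0 x)) < e).
  apply Rle_lt_trans with (1 := H).
  replace e with ((1 + norm (B x)) * (e / (1 + norm (B x)))) by (field; lra).
  apply Rmult_lt_compat_l; lra.
Qed.

Lemma semicocycle_norm_expansion {T : UniformSpace} {A : BanachAlgebra} (D : T -> Prop)
    (F : R -> T -> T) (G : R -> T -> A) (B : T -> A) :
  semicocycle D F G -> is_generator D G B ->
  forall x, D x -> forall e, 0 < e ->
  exists d, 0 < d /\ forall h, 0 < h < d ->
    Rabs (norm (G h x) - norm (plus ba_one (rscal h (B x)))) <= e * h.
Proof.
  intros HG HB x Dx e He.
  destruct (derive_halfline_expansion _ _ _ (HB x Dx) e He) as (d & Hd & H).
  exists d. split; [easy|]. intros h Hh.
  rewrite <- (Rabs_pos_eq h) at 3 by lra.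
  specialize (H h ltac:(lra) ltac:(rewrite Rabs_pos_eq; lra) ltac:(lra)).
  rewrite Rplus_0_l, (semicocycle_at_0 D F G B HG HB x Dx) in H.
  apply Rle_trans with (2 := H). apply norm_minus_le.
Qed.

Lemma is_mu_upper {A : BanachAlgebra} (a : A) (e : R) :
  0 < e -> exists d, 0 < d /\ forall h, 0 < h < d ->
    norm (plus ba_one (rscal h a)) <= 1 + (mu a + e) * h.
Proof.
  intros He.
  destruct (proj1 (filterlim_locally _ _) (mu_correct a) (mkposreal e He)) as [[d Hd] H].
  exists d. split; [easy|]. intros h Hh.
  assert (Hball : ball 0 d h).
  { change (Rabs (h - 0) < d). rewrite Rminus_0_r, Rabs_pos_eq; lra. }
  specialize (H h Hball (proj1 Hh)).
  change (Rabs (mu_quotient a h - mu a) < e) in H. apply Rabs_def2 in H.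
  replace (norm (plus ba_one (rscal h a))) with (1 + mu_quotient a h * h)
    by (unfold mu_quotient; field; lra).
  apply Rplus_le_compat_l, Rmult_le_compat_r; lra.
Qed.

Lemma mu_le_of_eventually {A : BanachAlgebra} (a : A) (M : R) :
  (exists d, 0 < d /\ forall h, 0 < h < d ->
     norm (plus ba_one (rscal h a)) <= 1 + M * h) ->
  mu a <= M.
Proof.
  intros (d & Hd & H).
  apply (filterlim_le (F := at_right 0) (mu_quotient a) (fun _ => M) (mu a) M).
  - exists (mkposreal d Hd). intros h Hh Hh0.
    change (Rabs (h - 0) < d) in Hh. rewrite Rminus_0_r, Rabs_pos_eq in Hh by lra.
    specialize (H h (conj Hh0 Hh)). unfold mu_quotient.
    apply Rle_div_l; [easy|]. lra.
  - apply mu_correct.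
  - apply filterlim_const.
Qed.

(** The derivative of exp (K h) at 0 is [K]. This puts the exponential bound in the linear form
    accepted by [mu_le_of_eventually]. *)
Lemma exp_linear_upper (K e : R) :
  0 < e -> exists d, 0 < d /\ forall h, 0 < h < d -> exp (K * h) <= 1 + (K + e) * h.
Proof.
  intros He.
  assert (Hder : is_derive (fun h => exp (K * h)) 0 K).
  { auto_derive; [easy|]. rewrite Rmult_0_r, exp_0. ring. }
  apply is_derive_Reals in Hder.
  destruct (Hder e He) as [[d Hd] H].
  exists d. split; [easy|]. intros h Hh.
  specialize (H h ltac:(lra) ltac:(simpl; rewrite Rabs_pos_eq; lra)).
  rewrite Rplus_0_l, Rmult_0_r, exp_0 in H. apply Rabs_def2 in H.
  replace (exp (K * h)) with (1 + (exp (K * h) - 1) / h * h) by (field; lra).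
  apply Rplus_le_compat_l, Rmult_le_compat_r; lra.
Qed.

(** * The two implications *)

(** For small [h], |1 + h B(x)| <= |Gamma_h(x)| + (e/2) h <= exp (K h) + (e/2) h <= 1 + (K + e)
    h. *)
Lemma generator_mu_le {T : UniformSpace} {A : BanachAlgebra} (D : T -> Prop)
    (F : R -> T -> T) (G : R -> T -> A) (B : T -> A) (K : R) (x : T) :
  semicocycle D F G -> is_generator D G B -> D x ->
  (forall t, 0 <= t -> norm (G t x) <= exp (K * t)) ->
  mu (B x) <= K.
Proof.
  intros HG HB Dx Hbound. apply le_epsilon. intros e He.
  destruct (semicocycle_norm_expansion D F G B HG HB x Dx (e / 2) ltac:(lra))
    as (d1 & Hd1 & H1).
  destruct (exp_linear_upper K (e / 2) ltac:(lra)) as (d2 & Hd2 & H2).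
  apply mu_le_of_eventually. exists (Rmin d1 d2). split; [now apply Rmin_glb_lt|].
  intros h Hh. pose proof (Rmin_l d1 d2). pose proof (Rmin_r d1 d2).
  specialize (H1 h ltac:(lra)). specialize (H2 h ltac:(lra)).
  specialize (Hbound h ltac:(lra)). apply Rabs_le_between in H1. lra.
Qed.

Lemma semicocycle_norm_right_step {T : UniformSpace} {A : BanachAlgebra} (D : T -> Prop)
    (F : R -> T -> T) (G : R -> T -> A) (B : T -> A) (x : T) (t e : R) :
  semicocycle D F G -> is_generator D G B -> D x -> D (F t x) -> 0 <= t -> 0 < e ->
  exists d, 0 < d /\ forall h, 0 < h < d ->
    norm (G (t + h) x) <= (1 + (mu (B (F t x)) + e) * h) * norm (G t x).
Proof.
  intros HG HB Dx Dy Ht He.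
  destruct (semicocycle_norm_expansion D F G B HG HB _ Dy (e / 2) ltac:(lra))
    as (d1 & Hd1 & H1).
  destruct (is_mu_upper (B (F t x)) (e / 2) ltac:(lra)) as (d2 & Hd2 & H2).
  exists (Rmin d1 d2). split; [now apply Rmin_glb_lt|].
  intros h Hh. pose proof (Rmin_l d1 d2). pose proof (Rmin_r d1 d2).
  specialize (H1 h ltac:(lra)). specialize (H2 h ltac:(lra)).
  apply Rabs_le_between in H1.
  (* With the short time [h] as the outer factor, the expansion at time 0 applies at the moved point
     [F t x]. *)
  rewrite Rplus_comm, <- (proj1 HG h t) by (easy || lra).
  apply Rle_trans with (norm (G h (F t x)) * norm (G t x)); [apply ba_norm_mult|].
  apply Rmult_le_compat_r; [apply norm_ge_0|]. lra.
Qed.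

(** The Lipschitz bound with the negative increment [s - t] supplies the left-limit hypothesis of
    [gronwall_right_step]. *)
Lemma derive_halfline_norm_left {A : BanachAlgebra} (v : R -> A) (t : R) (l : A) :
  is_derive_halfline v t l ->
  forall e, 0 < e ->
  exists d, 0 < d /\ forall s, 0 <= s -> t - d < s < t -> norm (v t) <= norm (v s) + e.
Proof.
  intros Hv e He.
  destruct (derive_halfline_lipschitz v t l Hv) as (d & Hd & H).
  pose proof (norm_ge_0 l) as Hl.
  exists (Rmin d (e / (1 + norm l))). split.
  { apply Rmin_glb_lt; [easy|]. apply Rdiv_lt_0_compat; lra. }
  intros s Hs0 Hs.
  pose proof (Rmin_l d (e / (1 + norm l))). pose proof (Rmin_r d (e / (1 + norm l))).
  assert (Habs : Rabs (s - t) = t - s) by (rewrite Rabs_left; lra).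
  specialize (H (s - t) ltac:(lra) ltac:(lra) ltac:(lra)).
  replace (t + (s - t)) with s in H by ring. rewrite Habs in H.
  assert (He' : (1 + norm l) * (t - s) <= e).
  { replace e with ((1 + norm l) * (e / (1 + norm l))) by (field; lra).
    apply Rmult_le_compat_l; lra. }
  pose proof (norm_minus_le (v s) (v t)) as Hn.
  apply Rabs_le_between in Hn. lra.
Qed.

(** The supremum lives in the extended reals, so the equivalence also covers an empty [E] (supremum
    -oo) and an unbounded one. *)
Lemma Lub_Rbar_le_iff (E : R -> Prop) (M : R) :
  Rbar_le (Lub_Rbar E) (Finite M) <-> forall r, E r -> r <= M.
Proof.
  destruct (Lub_Rbar_correct E) as [Hub Hlub]. split.
  - intros H r Er. exact (Rbar_le_trans (Finite r) _ (Finite M) (Hub r Er) H).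
  - intros H. now apply Hlub.
Qed.

Theorem proposition4p1
  (k : scalar_kind) (X : CompleteNormedModule (scalars k)) (A : BanachAlgebra)
  (D Dstar : X -> Prop) (F : R -> X -> X) (Gamma : R -> X -> A) (B : X -> A) (K : R)
  (HD : is_domain D)
  (HF : semigroup_on D F)
  (HDstar : forall x, Dstar x -> D x)
  (Hinv : invariant F Dstar)
  (HGamma : semicocycle D F Gamma)
  (HGamma_cont : forall t, 0 <= t -> continuous_on D (Gamma t))
  (HGamma_diff : differentiable_in_time D Gamma)
  (HB : is_generator D Gamma B)
  (HB_cont : continuous_on D B) :
  (forall t, 0 <= t ->
     Rbar_le (Lub_Rbar (fun r => exists x, Dstar x /\ r = norm (Gamma t x)))
             (Finite (exp (K * t))))
  <-> (forall x, Dstar x -> mu (B x) <= K).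
Proof.
  split.
  - intros H x Sx.
    apply (generator_mu_le D F Gamma B K x); auto.
    intros t Ht. apply (proj1 (Lub_Rbar_le_iff _ _) (H t Ht)). now exists x.
  - intros H t Ht. apply Lub_Rbar_le_iff. intros r (x & Sx & ->).
    assert (Dx : D x) by auto.
    assert (Hexp : forall e, 0 < e -> norm (Gamma t x) <= exp ((K + e) * t)).
    { intros e He.
      (* The factor equals 1 and plays the initial value [f 0] of the Gronwall bound. *)
      replace (exp ((K + e) * t)) with (norm (Gamma 0 x) * exp ((K + e) * t)).
      2:{ rewrite (semicocycle_at_0 D F Gamma B HGamma HB x Dx).
          replace (norm (@ba_one A)) with 1 by (symmetry; apply ba_norm_one). ring. }
      revert t Ht. apply (gronwall_right_step (fun s => norm (Gamma s x))).
      - intros s. apply norm_ge_0.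
      - intros s Hs.
        (* Invariance keeps the orbit in [Dstar], so [mu (B (F s x)) <= K] at every time [s]. *)
        assert (Sy : Dstar (F s x)) by now apply Hinv.
        destruct (semicocycle_norm_right_step D F Gamma B x s e) as (d & Hd & Hstep);
          auto.
        exists d. split; [easy|]. intros h Hh.
        apply Rle_trans with (1 := Hstep h Hh).
        apply Rmult_le_compat_r; [apply norm_ge_0|].
        apply Rplus_le_compat_l, Rmult_le_compat_r; [lra|].
        specialize (H _ Sy). lra.
      - intros s Hs. destruct (HGamma_diff x Dx s ltac:(lra)) as [l Hl].
        exact (derive_halfline_norm_left (fun r => Gamma r x) s l Hl). }
    assert (Hc : filterlim (fun e => exp ((K + e) * t)) (locally 0)
                   (locally (exp (K * t)))).
    { replace (exp (K * t)) with (exp ((K + 0) * t)) by (f_equal; ring).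
      apply (@ex_derive_continuous R_AbsRing R_NormedModule
               (fun e => exp ((K + e) * t))).
      auto_derive. easy. }
    (* The bound holds only for [e > 0], so [e] tends to 0 from the right. *)
    apply (filterlim_le (F := at_right 0)
             (fun _ => norm (Gamma t x)) (fun e => exp ((K + e) * t))
             (norm (Gamma t x)) (exp (K * t))).
    + exists (mkposreal 1 Rlt_0_1). intros e _ He. now apply Hexp.
    + apply filterlim_const.
    + intros P HP. destruct (Hc P HP) as [d Hd]. exists d. intros e He _. now apply Hd.
Qed.
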